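(* Let $n\ge1$ and let $\mathbb{Q}_n(\mathbb{R})$ be the set of $n\times n$ real matrices with all entries in $\{-1,1\}$. For $A\in\mathbb{Q}_n(\mathbb{R})$ let $\nu_A$ be the optimal value of the semidefinite program: maximize $\operatorname{Tr}(AX)$ over $X\in\mathbb{M}_n(\mathbb{R})$ subject to $\begin{bmatrix} I & X\\ X^T & I\end{bmatrix}\succeq 0$. Then the largest entrywise $1$-norm $\sum_{i,j}|x_{i,j}|$ of an $n\times n$ real orthogonal matrix $X$ equals $\max\{\nu_A: A\in\mathbb{Q}_n(\mathbb{R})\}$.
   Context: $\succeq 0$ means positive semidefinite; $I$ is the $n\times n$ identity matrix. *)

(* Defs.v *)
From HB Require Import structures.
From mathcomp Require Import all_boot all_order all_algebra.
From mathcomp Require Import sesquilinear.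
From mathcomp Require Import all_classical all_reals ereal.

Set Implicit Arguments.
Unset Strict Implicit.
Unset Printing Implicit Defensive.

Import Order.TTheory GRing.Theory Num.Theory.
Local Open Scope classical_set_scope.
Local Open Scope ring_scope.

Section Defs.
Context {R : realType}.

Definition psd n (M : 'M[R]_n) : Prop :=
  M \is symmetricmx /\ forall v : 'cV[R]_n, 0 <= (v^T *m M *m v) 0 0.

Definition sign_matrices n : set 'M[R]_n :=
  [set A : 'M[R]_n | forall i j, A i j = -1 \/ A i j = 1].

Definition orthogonal_matrices n : set 'M[R]_n :=
  [set X : 'M[R]_n | X^T *m X = 1%:M].

Definition entry_norm1 n (X : 'M[R]_n) : R := \sum_i \sum_j `|X i j|.

Definition sdp_feasible n : set 'M[R]_n :=
  [set X : 'M[R]_n | psd (block_mx 1%:M X X^T 1%:M)].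

(* The optimal value of the program is a supremum in the extended reals, so
   that neither boundedness nor feasibility is presupposed. *)
Definition sdp_value n (A : 'M[R]_n) : \bar R :=
  ereal_sup [set (\tr (A *m X))%:E | X in @sdp_feasible n].

End Defs.

Definition is_max d (T : porderType d) (S : set T) (m : T) : Prop :=
  S m /\ ubound S m.

(* Main.v *)
(* Compactness of the orthogonal group gives, for each matrix A, an orthogonal U
   maximising tr(AU). Comparing U with U H for reflections H shows that P = AU has
   a nonnegative quadratic form; comparing it with U G for plane rotations G shows
   that P is symmetric. If X is feasible, then Y = U^T X is a contraction, so
   v^T (1 - Y) v >= 0 for all v, and tr(AU) - tr(AX) = tr(P (1 - Y)) >= 0: the
   value of the program is tr(AU). For a sign matrix A this is at most the entrywise
   1-norm of U, and equality with the largest such norm holds for the transposed sign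
   pattern of an orthogonal matrix attaining it. *)
Require Import Defs.
From mathcomp Require Import all_boot all_order all_algebra.
From mathcomp Require Import sesquilinear ring lra.
From mathcomp Require Import all_classical all_reals ereal.
From mathcomp Require Import topology normedtype derive.

Import Order.TTheory GRing.Theory Num.Theory.
Import numFieldNormedType.Exports.
Local Open Scope classical_set_scope.
Local Open Scope ring_scope.

(** * Compactness of the orthogonal group and existence of maximizers *)

Section OrthogonalMaximum.
Context {R : realType} {n : nat}.
Implicit Types (X U : 'M[R]_n).

Lemma entry_vec_mx_continuous (i j : 'I_n) :
  continuous (fun v : 'rV[R]_(n * n) => vec_mx v i j).
Proof.
have -> : (fun v : 'rV[R]_(n * n) => vec_mx v i j) =
          (fun v : 'rV[R]_(n * n) => v 0 (mxvec_index i j)).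
  by apply/funext => v; rewrite mxE.
exact: coord_continuous.
Qed.

Lemma sum_continuous (T : topologicalType) (I : Type) (r : seq I)
    (F : I -> T -> R) :
  (forall i, continuous (F i)) -> continuous (fun x => \sum_(i <- r) F i x).
Proof.
by move=> Fc x; apply: cvg_big => [|i _]; [exact: add_continuous|exact: Fc].
Qed.

(** The square of [X i j] is one term of the sum of squares of column [j], which is 1. *)
Lemma orthogonal_entry_le1 X i j : X^T *m X = 1%:M -> `|X i j| <= 1.
Proof.
move=> XX; have := congr1 (fun M : 'M_n => M j j) XX.
rewrite !mxE eqxx (bigD1 i) //= !mxE => XX1.
have: 0 <= \sum_(k | k != i) X^T j k * X k j.
  by apply: sumr_ge0 => k _; rewrite !mxE -expr2 sqr_ge0.
move=> S0; rewrite -(@ler_pXn2r _ 2) ?nnegrE // expr1n real_normK ?num_real //.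
by move: XX1 S0 => /=; set s := \sum_(_ | _) _ => XX1 S0; rewrite expr2; lra.
Qed.

(** Flattened to row vectors, orthogonal matrices lie in the compact cube with sides [[-1, 1]]; they
    form a closed set because each entry of [X^T *m X] is continuous in [X]. *)
Lemma orthogonal_compact :
  compact [set v : 'rV[R]_(n * n) | orthogonal_matrices (vec_mx v)].
Proof.
pose K := [set v : 'rV[R]_(n * n) | forall k, `[-1, 1]%classic (v 0 k)].
have cK : compact K.
  apply: (@rV_compact R _ (fun=> `[-1, 1]%classic)) => k.
  exact: segment_compact.
apply: (subclosed_compact _ cK); last first.
  move=> v /= ov k; rewrite /= in_itv /= -ler_norml.
  case/mxvec_indexP: k => i j.
  by have := orthogonal_entry_le1 _ i j ov; rewrite mxE.
have -> : [set v : 'rV[R]_(n * n) | orthogonal_matrices (vec_mx v)] =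
  \bigcap_(ij in [set: 'I_n * 'I_n])
    (fun v : 'rV[R]_(n * n) => \sum_k vec_mx v k ij.1 * vec_mx v k ij.2)
       @^-1` [set (ij.1 == ij.2)%:R].
  apply/seteqP; split=> v /=.
    move=> ov [i j] _ /=; have := congr1 (fun M : 'M_n => M i j) ov.
    by rewrite !mxE => <-; apply: eq_bigr => k _; rewrite !mxE.
  move=> ov; apply/matrixP => i j; rewrite !mxE -(ov (i, j) I) /=.
  by apply: eq_bigr => k _; rewrite !mxE.
apply: closed_bigI => -[i j] _ /=.
apply: preimage_closed; last exact: closed_eq.
move=> v _; apply: sum_continuous => k {}v.
exact: (cvgM (entry_vec_mx_continuous k i v) (entry_vec_mx_continuous k j v)).
Qed.

Lemma orthogonal_EVT_max (f : 'M[R]_n -> R) :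
  continuous (fun v : 'rV[R]_(n * n) => f (vec_mx v)) ->
  exists2 U, orthogonal_matrices U &
    forall X, orthogonal_matrices X -> f X <= f U.
Proof.
move=> fc.
have [|v /[!inE]/= vo vmax] :=
    compact_EVT_max _ orthogonal_compact (continuous_subspaceT fc).
  by exists (mxvec 1%:M); rewrite /= /orthogonal_matrices /= mxvecK trmx1 mul1mx.
exists (vec_mx v) => // X Xo.
by have := vmax (mxvec X); rewrite inE /= mxvecK; apply.
Qed.

End OrthogonalMaximum.

(** * Traces of products of matrices with nonnegative quadratic forms *)

Section TracePsd.
Context {R : realType} {n : nat}.
Implicit Types (P Z : 'M[R]_n) (u v : 'cV[R]_n).

Definition quad P v : R := (v^T *m P *m v) 0 0.

Lemma quadD P u v t : P^T = P ->
  quad P (u + t *: v) = quad P u + t * (v^T *m P *m u) 0 0 *+ 2 + t ^+ 2 * quad P v.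
Proof.
move=> sP; rewrite /quad [(u + _)^T]linearD /= [(t *: _)^T]linearZ /= !(mulmxDl, mulmxDr).
rewrite -!scalemxAl -!scalemxAr.
have eP : (u^T *m P *m v) 0 0 = (v^T *m P *m u) 0 0.
  by rewrite -[u^T *m P *m v]trmxK mxE !trmx_mul trmxK sP mulmxA.
have mxD (A B : 'M[R]_1) : (A + B) 0 0 = A 0 0 + B 0 0 by rewrite mxE.
have mxZ c (A : 'M[R]_1) : (c *: A) 0 0 = c * A 0 0 by rewrite mxE.
rewrite !(mxD, mxZ) eP.
ring.
Qed.

Lemma quad_delta P k : quad P (delta_mx k 0) = P k k.
Proof. by rewrite /quad trmx_delta -rowE -colE !mxE. Qed.

Lemma delta_quad P k v : ((delta_mx k 0 : 'cV_n)^T *m P *m v) 0 0 = (row k P *m v) 0 0.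
Proof. by rewrite trmx_delta -rowE. Qed.

Lemma psd_diag_eq0 P k : P^T = P -> (forall v, 0 <= quad P v) ->
  P k k = 0 -> row k P = 0.
Proof.
move=> sP P0 Pkk; apply/rowP => j; rewrite !mxE.
have [//|x0] := eqVneq (P k j) 0.
(* As [P k k = 0], the form at [e_j + t e_k] is affine in [t], namely [P j j + 2 t P k j]; this [t]
   makes it [- P j j - 2 < 0]. *)
have := P0 (delta_mx j 0 + (- (P j j + 1) / P k j) *: delta_mx k 0).
rewrite quadD // delta_quad -colE !quad_delta Pkk !mxE divfK //.
by have := P0 (delta_mx j 0); rewrite quad_delta => Pjj; lra.
Qed.

(* One step of Gaussian elimination writes [P] as a positive semidefinite
   matrix with one more zero row plus a nonnegative multiple of [w w^T], where
   [w] is a column of [P]. *)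
Lemma trace_psd_ge0 P Z : P^T = P ->
  (forall v, 0 <= quad P v) -> (forall v, 0 <= quad Z v) -> 0 <= \tr (P *m Z).
Proof.
move=> + + Z0.
(* Induction on a bound [k] beyond which all rows of [P] vanish. *)
suff H k : (k <= n)%N -> forall P, (forall i : 'I_n, (k <= i)%N -> row i P = 0) ->
    P^T = P -> (forall v, 0 <= quad P v) -> 0 <= \tr (P *m Z).
  by apply: (H n) => // i; rewrite leqNgt ltn_ord.
elim: k => [|k IH] kn {}P rP sP P0.
  rewrite (_ : P = 0) ?mul0mx ?linear0 //.
  by apply/row_matrixP => i; rewrite rP // row0.
pose i := Ordinal kn; set a := P i i.
have a0 : 0 <= a by rewrite /a -quad_delta.
have cP : col i P = (row i P)^T by rewrite tr_row sP.
(* If [a = 0], the convention [0^-1 = 0] gives [P' = P], and row [i] is already zero by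
   [psd_diag_eq0]. *)
pose P' := P - a^-1 *: (col i P *m row i P).
have -> : P = P' + a^-1 *: (col i P *m row i P) by rewrite subrK.
rewrite mulmxDl linearD /= -scalemxAl linearZ /= -(mulmxA (col i P)).
rewrite (mxtrace_mulC (col i P)).
rewrite [\tr (_ *m col i P)]/mxtrace big_ord1; apply: addr_ge0; last first.
  apply: mulr_ge0; first by rewrite invr_ge0.
  by have := Z0 (col i P); rewrite /quad cP trmxK.
apply: IH; first exact: ltnW.
- move=> j; rewrite leq_eqVlt => /orP[/eqP kj|kj]; last first.
    have rj := rP j kj; apply/rowP => l.
    have rjE m : P j m = 0 by have := congr1 (fun r : 'rV_n => r 0 m) rj; rewrite !mxE.
    by rewrite !mxE big_ord1 !mxE !rjE mul0r mulr0 subrr.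
  have -> : j = i by exact: val_inj.
  apply/rowP => l; rewrite !mxE big_ord1 !mxE -/a.
  have [a00|an0] := eqVneq a 0; last by rewrite mulrA mulVf // mul1r subrr.
  have := congr1 (fun r : 'rV_n => r 0 l) (psd_diag_eq0 _ _ sP P0 a00).
  by rewrite !mxE => ->; rewrite !mulr0 subrr.
- by rewrite /P' linearB linearZ /= trmx_mul cP trmxK sP.
- move=> v; set b := (row i P *m v) 0 0.
  (* Completing the square: [t = - b / a] minimizes the form of [P] at [v + t e_i], and the minimum
     is the form of [P'] at [v]. *)
  suff -> : quad P' v = quad P (v + (- (a^-1 * b)) *: delta_mx i 0) by [].
  rewrite quadD // delta_quad quad_delta -/a -/b.
  have -> : quad P' v = quad P v - a^-1 * b ^+ 2.
    rewrite /quad /P' mulmxBr mulmxBl -scalemxAr -scalemxAl.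
    have -> : v^T *m (col i P *m row i P) *m v = (row i P *m v)^T *m (row i P *m v).
      by rewrite trmx_mul -cP !mulmxA.
    rewrite mxE; congr (_ + _); rewrite mxE; congr (- _); rewrite mxE; congr (_ * _).
    by rewrite mxE big_ord1 mxE expr2.
  have [a00|an0] := eqVneq a 0; first by rewrite a00 invr0; ring.
  by field.
Qed.

End TracePsd.

(** * Orthogonal maximizers of the trace solve the semidefinite program *)

Section TraceMaximizer.
Context {R : realType} {n : nat}.
Implicit Types (A U X K : 'M[R]_n) (v : 'cV[R]_n).

Lemma orthogonalM U X : orthogonal_matrices U -> orthogonal_matrices X ->
  orthogonal_matrices (U *m X).
Proof.
by rewrite /orthogonal_matrices /= trmx_mul => oU oX; rewrite mulmxA -(mulmxA X^T) oU mulmx1.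
Qed.

Lemma sqnorm_ge0 v : 0 <= (v^T *m v) 0 0.
Proof. by rewrite mxE sumr_ge0 // => i _; rewrite mxE -expr2 sqr_ge0. Qed.

Lemma sqnorm_eq0 v : (v^T *m v) 0 0 = 0 -> v = 0.
Proof.
rewrite mxE => /psumr_eq0P v0; apply/colP => i; rewrite !mxE.
have /eqP := v0 (fun i _ => ltac:(by rewrite mxE -expr2 sqr_ge0)) i isT.
by rewrite mxE -expr2 sqrf_eq0 => /eqP.
Qed.

(** This is the Householder reflection along [v], a symmetric involution. *)
Lemma reflection_orthogonal v : v != 0 ->
  orthogonal_matrices (1%:M - (2 / (v^T *m v) 0 0) *: (v *m v^T)).
Proof.
move=> v0; set s := (v^T *m v) 0 0; have s0 : s != 0.
  by apply: contra_neq v0 => /sqnorm_eq0.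
rewrite /orthogonal_matrices /= [(_ - _)^T]linearB /= [(_ *: _)^T]linearZ /= trmx1 trmx_mul trmxK.
rewrite mulmxBl !mulmxBr !mul1mx !mulmx1 -scalemxAl -scalemxAr mulmxA.
rewrite -(mulmxA v) [v^T *m v]mx11_scalar -/s mul_mx_scalar -scalemxAl !scalerA.
rewrite -scalerBl -addrA -opprD -scalerDl.
have -> : 2 / s + (2 / s - 2 / s * (2 / s * s)) = 0 by field.
by rewrite scale0r subr0.
Qed.

(** Rodrigues' formula for [exp (x K)], with [t = tan (x / 2)]: the coefficients are [1 - cos x] and
    [sin x] in rational form. *)
Lemma rotation_orthogonal K t : K^T = - K -> K *m K *m K = - K ->
  orthogonal_matrices (1%:M + (2 * t ^+ 2 / (1 + t ^+ 2)) *: (K *m K)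
                            + (2 * t / (1 + t ^+ 2)) *: K).
Proof.
move=> sK K3; have t1 : 1 + t ^+ 2 != 0 by rewrite lt0r_neq0 // ltr_pwDl ?sqr_ge0.
set a := 2 * t ^+ 2 / _; set b := 2 * t / _.
(* This is [(1 - a)^2 + b^2 = 1]; the left side is the coefficient of [K *m K] in the product to be
   computed. *)
have ab : a + a - a ^+ 2 - b ^+ 2 = 0 by rewrite /a /b; field.
have K4 : K *m K *m (K *m K) = - (K *m K) by rewrite mulmxA K3 mulNmx.
have trD (B C : 'M[R]_n) : (B + C)^T = B^T + C^T by exact: linearD.
have trZ c (B : 'M[R]_n) : (c *: B)^T = c *: B^T by exact: linearZ.
rewrite /orthogonal_matrices /= !trD !trZ trmx1 trmx_mul sK.
rewrite mulNmx mulmxN opprK scalerN mulmxBl !mulmxDl !mulmxDr !mul1mx !mulmx1.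
rewrite -!scalemxAl -!scalemxAr K4 K3 ?mulmxA ?K3 !scalerN !scalerA.
move: (K *m K) => M; apply/matrixP => p q; rewrite !mxE.
by rewrite -[RHS]addr0 -(mul0r (M p q)) -ab; ring.
Qed.

Lemma mxtrace_mul_delta A i j : \tr (A *m delta_mx i j) = A j i.
Proof.
rewrite -(mul_delta_mx (0 : 'I_1)) mulmxA mxtrace_mulC -rowE -colE /mxtrace big_ord1.
by rewrite !mxE.
Qed.

Lemma sdp_quadE X (u v : 'cV[R]_n) :
  quad (block_mx 1%:M X X^T 1%:M) (col_mx u v) =
  (u^T *m u) 0 0 + (u^T *m X *m v) 0 0 *+ 2 + (v^T *m v) 0 0.
Proof.
have eX : (u^T *m X *m v) 0 0 = (v^T *m X^T *m u) 0 0.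
  by rewrite -[u^T *m X *m v]trmxK mxE !trmx_mul trmxK mulmxA.
rewrite /quad tr_col_mx mul_row_block mul_row_col !mulmxDl !mulmx1.
have mxD (B C : 'M[R]_1) : (B + C) 0 0 = B 0 0 + C 0 0 by rewrite mxE.
by rewrite !mxD eX; ring.
Qed.

Section Maximizer.
Variables A U : 'M[R]_n.
Hypothesis Uo : orthogonal_matrices U.
Hypothesis Umax : forall X, orthogonal_matrices X -> \tr (A *m X) <= \tr (A *m U).

(** Multiplying [U] by the reflection along [v] changes the trace by [-2 / s] times the form at [v],
    which cannot be positive. *)
Lemma maximizer_quad_ge0 v : 0 <= quad (A *m U) v.
Proof.
have [->|v0] := eqVneq v 0; first by rewrite /quad mulmx0 mxE.
have := Umax _ (orthogonalM _ _ Uo (reflection_orthogonal _ v0)).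
set s := (v^T *m v) 0 0.
have s0 : 0 < s.
  by rewrite lt0r sqnorm_ge0 andbT; apply: contra_neq v0 => /sqnorm_eq0.
rewrite mulmxA mulmxBr mulmx1 linearB /= -scalemxAr linearZ /= (mulmxA _ v).
rewrite (mxtrace_mulC _ v^T) mulmxA [\tr (_ *m v)]/mxtrace big_ord1 lerBlDr lerDl pmulr_rge0 //.
by rewrite divr_gt0.
Qed.

(* The rotations [1 + (1 - cos x) K^2 + (sin x) K] cannot increase the trace, so the
   derivative [\tr (A *m U *m K)] at [x = 0] vanishes; [t] is [tan (x / 2)]. *)
Lemma maximizer_skew K : K^T = - K -> K *m K *m K = - K -> \tr (A *m U *m K) = 0.
Proof.
move=> sK K3; pose a := \tr (A *m U *m (K *m K)); pose b := \tr (A *m U *m K).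
have ab t : t ^+ 2 * a + t * b <= 0.
  have := Umax _ (orthogonalM _ _ Uo (rotation_orthogonal _ t sK K3)).
  rewrite mulmxA !mulmxDr mulmx1 -!scalemxAr !mxtraceD !mxtraceZ -/a -/b.
  have t1 : 0 < 1 + t ^+ 2 by rewrite ltr_pwDl ?sqr_ge0.
  rewrite -addrA gerDl => H.
  have : (1 + t ^+ 2) / 2 * (2 * t ^+ 2 / (1 + t ^+ 2) * a + 2 * t / (1 + t ^+ 2) * b) <= 0.
    by rewrite pmulr_rle0 // divr_gt0.
  by congr (_ <= _); field; rewrite lt0r_neq0.
have c0 : 0 < a ^+ 2 + 1 by rewrite ltr_wpDl ?sqr_ge0.
(* For this [t], [b = t (a^2 + 1)], so the bound reads [t^2 (a^2 + a + 1) <= 0]; the second factor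
   is positive, hence [t = 0] and [b = 0]. *)
have := ab (b / (a ^+ 2 + 1)).
have -> : (b / (a ^+ 2 + 1)) ^+ 2 * a + b / (a ^+ 2 + 1) * b =
            (b / (a ^+ 2 + 1)) ^+ 2 * (a + a ^+ 2 + 1) by field; rewrite lt0r_neq0.
rewrite pmulr_lle0; last by nra.
rewrite le_eqVlt ltNge sqr_ge0 orbF sqrf_eq0 mulf_eq0 invr_eq0.
by rewrite (gt_eqF c0) orbF => /eqP.
Qed.

Lemma maximizer_sym : (A *m U)^T = A *m U.
Proof.
apply/matrixP => i j; rewrite mxE; have [->//|ij] := eqVneq i j.
(* The generator of rotations in the plane of [e_i] and [e_j]; its trace against [P] is
   [P j i - P i j]. *)
pose K : 'M[R]_n := delta_mx i j - delta_mx j i.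
have sK : K^T = - K by rewrite /K linearB /= !trmx_delta opprB.
have K2 : K *m K = - (delta_mx i i + delta_mx j j).
  rewrite /K mulmxBl !mulmxBr !mul_delta_mx !mul_delta_mx_0 // 1?eq_sym //.
  by rewrite sub0r subr0 opprD.
have K3 : K *m K *m K = - K.
  rewrite K2 mulNmx /K mulmxBr !mulmxDl !mul_delta_mx !mul_delta_mx_0 // 1?eq_sym //.
  by rewrite addr0 add0r.
have := maximizer_skew _ sK K3.
by rewrite /K mulmxBr linearB /= !mxtrace_mul_delta => /eqP; rewrite subr_eq0 => /eqP.
Qed.

Lemma maximizer_sdp X : sdp_feasible X -> \tr (A *m X) <= \tr (A *m U).
Proof.
move=> [_ Xpsd].
have UU : U *m U^T = 1%:M by exact: mulmx1C.
rewrite -subr_ge0 -linearB /= (_ : _ - _ = A *m U *m (1%:M - U^T *m X)); last first.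
  by rewrite mulmxBr mulmx1 mulmxA -(mulmxA A U) UU mulmx1.
apply: trace_psd_ge0; [exact: maximizer_sym|exact: maximizer_quad_ge0|].
(* At [(U v, - v)] the block form equals twice the form of [1 - U^T X] at [v]. *)
move=> v; have := Xpsd (col_mx (U *m v) (- v)).
rewrite -[(_ *m _) 0 0]/(quad _ _) sdp_quadE.
have -> : ((U *m v)^T *m (U *m v)) 0 0 = (v^T *m v) 0 0.
  by rewrite trmx_mul mulmxA -(mulmxA v^T) Uo mulmx1.
have -> : ((- v)^T *m - v) 0 0 = (v^T *m v) 0 0.
  by rewrite [(- v)^T]linearN /= mulNmx mulmxN opprK.
have -> : ((U *m v)^T *m X *m - v) 0 0 = - (v^T *m (U^T *m X) *m v) 0 0.
  by rewrite mulmxN mxE trmx_mul !mulmxA.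
rewrite /quad mulmxBr mulmxBl mulmx1.
have mxB (B C : 'M[R]_1) : (B - C) 0 0 = B 0 0 - C 0 0 by rewrite !mxE.
by rewrite mxB => H; lra.
Qed.

End Maximizer.

(** Since [X^T *m X = 1], the block form at [(u, v)] is the squared norm of [u + X v]. *)
Lemma orthogonal_sdp_feasible X : orthogonal_matrices X -> sdp_feasible X.
Proof.
move=> Xo; split.
  by apply/is_hermitianmxP; rewrite expr0 scale1r map_mx_id // tr_block_mx !trmx1 trmxK.
move=> w; rewrite -[w]vsubmxK -[(_ *m _) 0 0]/(quad _ _) sdp_quadE.
set u := usubmx w; set v := dsubmx w.
have := sqnorm_ge0 (u + X *m v).
have eX : (u^T *m X *m v) 0 0 = (v^T *m X^T *m u) 0 0.
  by rewrite -[u^T *m X *m v]trmxK mxE !trmx_mul trmxK mulmxA.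
have mxD (B C : 'M[R]_1) : (B + C) 0 0 = B 0 0 + C 0 0 by rewrite mxE.
rewrite [(_ + _)^T]linearD /= trmx_mul mulmxDl !mulmxDr !mxD !mulmxA -(mulmxA v^T X^T X) Xo mulmx1.
by rewrite eX => H; lra.
Qed.

End TraceMaximizer.

(** * Values of the program and the entrywise norm *)

Section SdpValue.
Context {R : realType} {n : nat}.
Implicit Types A X U : 'M[R]_n.

Lemma entry_norm1_attained : exists2 U, @orthogonal_matrices R n U &
  forall X, orthogonal_matrices X -> entry_norm1 X <= entry_norm1 U.
Proof.
apply: orthogonal_EVT_max; rewrite /entry_norm1.
apply: sum_continuous => i; apply: sum_continuous => j v.
exact: (cvg_norm (entry_vec_mx_continuous i j v)).
Qed.

Lemma sdp_value_attained A : exists2 U, orthogonal_matrices U &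
  sdp_value A = (\tr (A *m U))%:E.
Proof.
have [|U Uo Umax] := @orthogonal_EVT_max R n (fun X => \tr (A *m X)).
  have -> : (fun v : 'rV[R]_(n * n) => \tr (A *m vec_mx v)) =
            (fun v => \sum_i \sum_j A i j * vec_mx v j i).
    by apply/funext => v; apply: eq_bigr => i _; rewrite !mxE.
  apply: sum_continuous => i; apply: sum_continuous => j v.
  exact: (cvgMr (entry_vec_mx_continuous j i v)).
exists U => //; apply/eqP; rewrite eq_le; apply/andP; split.
  apply: ge_ereal_sup => _ [X Xf <-]; rewrite lee_fin.
  exact: (maximizer_sdp _ _ Uo Umax).
by apply: ereal_sup_ubound; exists U => //; exact: orthogonal_sdp_feasible.
Qed.

Lemma mxtrace_sign_le A X : sign_matrices A -> \tr (A *m X) <= entry_norm1 X.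
Proof.
move=> sA; rewrite /entry_norm1 exchange_big /mxtrace; apply: ler_sum => i _.
rewrite mxE; apply: ler_sum => j _; rewrite (le_trans (ler_norm _)) // normrM.
by case: (sA i j) => ->; rewrite ?normrN normr1 mul1r.
Qed.

Lemma entry_norm1_sign X :
  exists2 A, sign_matrices A & \tr (A *m X) = entry_norm1 X.
Proof.
(* The signs are transposed because the trace pairs [A i j] with [X j i]; a zero entry gets sign
   [1]. *)
exists (\matrix_(i, j) (-1) ^+ (X j i < 0)%R).
  by move=> i j; rewrite mxE; case: (_ < _); [left|right].
rewrite /entry_norm1 exchange_big /mxtrace; apply: eq_bigr => i _.
by rewrite mxE; apply: eq_bigr => j _; rewrite mxE [RHS]normrEsign.
Qed.

End SdpValue.

Theorem theorem9 (R : realType) (n : nat) (hn : (1 <= n)%N) :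
  exists m : R,
    is_max [set entry_norm1 X | X in @orthogonal_matrices R n] m /\
    is_max [set sdp_value A | A in @sign_matrices R n] m%:E.
Proof.
have [X Xo Xmax] := @entry_norm1_attained R n.
have sdp_le (A : 'M[R]_n) : sign_matrices A -> (sdp_value A <= (entry_norm1 X)%:E)%E.
  move=> sA; have [U Uo ->] := sdp_value_attained A.
  by rewrite lee_fin; apply: (le_trans (mxtrace_sign_le _ _ sA)); exact: Xmax.
exists (entry_norm1 X); split; split.
- by exists X.
- by move=> _ [Y Yo <-]; exact: Xmax.
(* [X] is itself feasible, so the value at its sign pattern is at least [entry_norm1 X]; [sdp_le]
   gives the converse. *)
- have [A sA AX] := entry_norm1_sign X; exists A => //.
  apply/eqP; rewrite eq_le sdp_le // -AX.
  by apply: ereal_sup_ubound; exists X => //; exact: orthogonal_sdp_feasible.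
- by move=> _ [A sA <-]; exact: sdp_le.
Qed.
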